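(* Let $\mathbb{F}$ be a finite field. For every $d\in\mathbb{N}$ there exists a CMSO sentence $\mathrm{csd}_d$ over the signature $\Sigma_{\mathbb{F}}$ such that for every matrix $A$ over $\mathbb{F}$ we have $\mathcal{S}(A)\models \mathrm{csd}_d$ if and only if $\mathrm{csd}(M(A))\le d$.
   Context: $\Sigma_{\mathbb{F}}$ consists of unary relation symbols $R,C$ and binary relation symbols $\mathrm{Entry}_\alpha$ for $\alpha\in\mathbb{F}$. For a matrix $A$, the structure $\mathcal{S}(A)$ has universe the (disjoint) union of the set of rows and the set of columns of $A$, interprets $R$ as the set of rows, $C$ as the set of columns, and $\mathrm{Entry}_\alpha$ as $\{(r,c): A(r,c)=\alpha\}$. CMSO is monadic second-order logic (quantification over elements and over sets of elements, with membership $x\in X$) extended with predicates $\mathrm{mod}_{a,b}(X)$ expressing $|X|\equiv a \pmod b$. Contraction$^*$-depth: for $A$ with $m$ rows and a subspace $K\subseteq\mathbb{F}^m$, $M(A,K)$ is the matroid on the columns where a set $\{u_1,\dots,u_\ell\}$ is dependent iff $\sum\alpha_iu_i\in K$ for some $\alpha_i$ not all $0$; $\mathrm{csd}(A,K)=0$ if $M(A,K)$ has rank $0$; otherwise if $M(A,K)$ is disconnected (not every two elements lie in a common circuit), $\mathrm{csd}(A,K)=\max_C\mathrm{csd}(A_C,K)$ over connected components $C$ ($A_C$ the submatrix of columns of $C$); otherwise $\mathrm{csd}(A,K)=1+\min_{v\in\mathbb{F}^m}\mathrm{csd}(A,K+\mathrm{span}(v))$; $\mathrm{csd}(M(A))=\mathrm{csd}(A,\{0\})$.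 *)

(* Defs.v *)
From HB Require Import structures.
From mathcomp Require Import all_boot all_order all_algebra.
Set Implicit Arguments. Unset Strict Implicit. Unset Printing Implicit Defensive.
Import GRing.Theory.
Local Open Scope ring_scope.

(* First-order variables and set variables are both named by nat, in
   separate namespaces. *)
Inductive cmso (F : Type) : Type :=
| CR     : nat -> cmso F
| CC     : nat -> cmso F
| CEntry : F -> nat -> nat -> cmso F
| CEq    : nat -> nat -> cmso F
| CIn    : nat -> nat -> cmso F
| CMod   : nat -> nat -> nat -> cmso F         (* mod_{a,b}(X) : |X| = a mod b *)
| CNot   : cmso F -> cmso F
| CAnd   : cmso F -> cmso F -> cmso F
| COr    : cmso F -> cmso F -> cmso F
| CEx1   : nat -> cmso F -> cmso F
| CAll1  : nat -> cmso F -> cmso F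
| CEx2   : nat -> cmso F -> cmso F
| CAll2  : nat -> cmso F -> cmso F.

Arguments CR {F}. Arguments CC {F}. Arguments CEq {F}. Arguments CIn {F}.
Arguments CMod {F}.

Fixpoint fv1 (F : Type) (phi : cmso F) : seq nat :=
  match phi with
  | CR x | CC x => [:: x]
  | CEntry _ x y | CEq x y => [:: x; y]
  | CIn x _ => [:: x]
  | CMod _ _ _ => [::]
  | CNot p => fv1 p
  | CAnd p q | COr p q => fv1 p ++ fv1 q
  | CEx1 x p | CAll1 x p => [seq y <- fv1 p | y != x]
  | CEx2 _ p | CAll2 _ p => fv1 p
  end.

Fixpoint fv2 (F : Type) (phi : cmso F) : seq nat :=
  match phi with
  | CR _ | CC _ | CEntry _ _ _ | CEq _ _ => [::]
  | CIn _ X | CMod _ _ X => [:: X]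
  | CNot p => fv2 p
  | CAnd p q | COr p q => fv2 p ++ fv2 q
  | CEx1 _ p | CAll1 _ p => fv2 p
  | CEx2 X p | CAll2 X p => [seq Y <- fv2 p | Y != X]
  end.

Definition cmso_sentence (F : Type) (phi : cmso F) : Prop :=
  fv1 phi = [::] /\ fv2 phi = [::].

Record sigma_struct (F : Type) := SigmaStruct {
  su : finType;
  sR : pred su;
  sC : pred su;
  sEntry : F -> rel su }.

Section Semantics.
Variables (F : Type) (M : sigma_struct F).

Definition upd1 (e : nat -> option (su M)) (x : nat) (a : su M) :=
  fun y => if y == x then Some a else e y.
Definition upd2 (e : nat -> {set su M}) (X : nat) (A : {set su M}) :=
  fun Y => if Y == X then A else e Y.

(* e1 : partial assignment of element variables (unassigned atoms are false);
   e2 : assignment of set variables. *)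
Fixpoint sat (e1 : nat -> option (su M)) (e2 : nat -> {set su M})
    (phi : cmso F) : Prop :=
  match phi with
  | CR x => if e1 x is Some a then @sR F M a else False
  | CC x => if e1 x is Some a then @sC F M a else False
  | CEntry al x y =>
      match e1 x, e1 y with Some a, Some b => @sEntry F M al a b | _, _ => False end
  | CEq x y => match e1 x, e1 y with Some a, Some b => a = b | _, _ => False end
  | CIn x X => if e1 x is Some a then a \in e2 X else False
  | CMod a b X => #|e2 X| = a %[mod b]
  | CNot p => ~ sat e1 e2 p
  | CAnd p q => sat e1 e2 p /\ sat e1 e2 q
  | COr p q => sat e1 e2 p \/ sat e1 e2 q
  | CEx1 x p => exists a : su M, sat (upd1 e1 x a) e2 p
  | CAll1 x p => forall a : su M, sat (upd1 e1 x a) e2 p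
  | CEx2 X p => exists A : {set su M}, sat e1 (upd2 e2 X A) p
  | CAll2 X p => forall A : {set su M}, sat e1 (upd2 e2 X A) p
  end.

Definition models (phi : cmso F) : Prop := sat (fun _ => None) (fun _ => set0) phi.

End Semantics.

Definition S_of_matrix (F : eqType) (m n : nat) (A : 'M[F]_(m, n)) : sigma_struct F :=
  @SigmaStruct F ('I_m + 'I_n)%type
    (fun x => if x is inl _ then true else false)
    (fun x => if x is inr _ then true else false)
    (fun al x y => match x, y with
                   | inl r, inr c => A r c == al
                   | _, _ => false end).

(* Vectors of F^m are row vectors 'rV[F]_m; a subspace K of F^m is      *)
(* represented (mxalgebra) by the row space of a matrix K : 'M[F]_m.     *)
(* The matroid M(A_S, K) is represented by its ground set S, a subset   *)
(* of the columns of A (so A_S, the submatrix of columns in S, is       *)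
(* represented by the pair (A, S)).                                     *)
Section Csd.
Variables (F : finFieldType) (m n : nat) (A : 'M[F]_(m, n)).

Definition colv (j : 'I_n) : 'rV[F]_m := (col j A)^T.

Definition mdep (K : 'M[F]_m) (T : {set 'I_n}) : bool :=
  [exists al : {ffun 'I_n -> F},
     [exists i in T, al i != 0] &&
     ((\sum_(i in T) al i *: colv i)%R <= K)%MS].

Definition mcircuit (K : 'M[F]_m) (S Cc : {set 'I_n}) : bool :=
  [&& Cc \subset S, mdep K Cc &
      [forall C' : {set 'I_n}, (C' \proper Cc) ==> ~~ mdep K C']].

Definition mrank (K : 'M[F]_m) (S : {set 'I_n}) : nat :=
  \max_(T : {set 'I_n} | (T \subset S) && ~~ mdep K T) #|T|.

Definition common_circuit (K : 'M[F]_m) (S : {set 'I_n}) (x y : 'I_n) : bool :=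
  [exists Cc : {set 'I_n}, [&& mcircuit K S Cc, x \in Cc & y \in Cc]].

Definition mconnected (K : 'M[F]_m) (S : {set 'I_n}) : bool :=
  [forall x in S, forall y in S, (x != y) ==> common_circuit K S x y].

Definition mcomponent (K : 'M[F]_m) (S : {set 'I_n}) (x : 'I_n) : {set 'I_n} :=
  [set y in S | (y == x) || common_circuit K S x y].

Definition is_component (K : 'M[F]_m) (S Cc : {set 'I_n}) : Prop :=
  exists2 x, x \in S & Cc = mcomponent K S x.

(* csd_le S K d  <->  csd(A_S, K) <= d, following the recursive definition:
   csd = 0 if rank 0; max over components if disconnected;
   1 + min_v csd(A, K + span v) otherwise. *)
Inductive csd_le : {set 'I_n} -> 'M[F]_m -> nat -> Prop :=
| csd_rank0 S K d : mrank K S = 0%N -> csd_le S K d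
| csd_disconn S K d :
    mrank K S != 0%N -> ~~ mconnected K S ->
    (forall Cc, is_component K S Cc -> csd_le Cc K d) -> csd_le S K d
| csd_contract S K d (v : 'rV[F]_m) :
    mrank K S != 0%N -> mconnected K S ->
    csd_le S (K + v)%MS d -> csd_le S K d.+1.

End Csd.

Definition csd_matrix_le (F : finFieldType) (m n : nat) (A : 'M[F]_(m, n)) (d : nat) : Prop :=
  csd_le A [set: 'I_n] (0 : 'M[F]_m) d.

(* Main.v *)
Require Import Defs.
From Corelib Require Import Setoid.
From mathcomp Require Import all_boot all_order all_algebra finfield.
Set Implicit Arguments. Unset Strict Implicit. Unset Printing Implicit Defensive.
Import GRing.Theory.
Local Open Scope ring_scope.

(* A subspace reached by the recursion is spanned by at most [d] vectors, and a
   function with values in the finite field [F] is a family of [#|F|] sets, so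
   both [K] and a linear combination of columns are values of set variables. The
   row [r] of a linear combination is computed by counting, modulo the
   characteristic, the columns contributing each field element; hence dependence,
   circuits, connectedness and components are definable. Being in a common
   circuit is transitive, so components are connected and each level of the
   recursion unfolds into one formula. *)

(** * Circuits and components *)

(** Formulas are hardly ever written out. Definability is treated semantically, as the existence of
    one formula expressing a relation between a matrix of any size and an assignment, and is shown
    to be stable under connectives, quantifiers and field operations. The obstacle then is variable
    capture. Set variables are therefore handed out in increasing order: a relation reads only
    variables below some [k], each new object is stored from [k] on, and [agree k] phrases the
    insensitivity to everything stored there. A contracted vector may be any element of F^m, not
    only a column, so it has to be guessed as a function on the rows. *)

Section Circuits.
Variables (F : finFieldType) (m n : nat) (A : 'M[F]_(m, n)) (K : 'M[F]_m).
Implicit Types (al be : {ffun 'I_n -> F}) (C S T : {set 'I_n}).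

(** Coefficients are indexed by all columns, and the set is recovered as the support; relations
    living on different sets can then be subtracted. *)
Definition dep_vector al : bool := ((\sum_i al i *: colv A i)%R <= K)%MS.
Definition fsupp al : {set 'I_n} := [set i | al i != 0].

Lemma mdepP T :
  reflect (exists al, [/\ fsupp al != set0, fsupp al \subset T & dep_vector al])
          (mdep A K T).
Proof.
apply: (iffP existsP) => [[al /andP[/existsP[i /andP[iT ali]] aK]]|[al [a0 aT aK]]].
  exists [ffun j => if j \in T then al j else 0]; split.
  - by apply/set0Pn; exists i; rewrite inE ffunE iT.
  - by apply/subsetP => j; rewrite inE ffunE; case: ifP; rewrite ?eqxx.
  - rewrite /dep_vector (bigID (mem T)) /= [X in _ + X]big1 ?addr0.
      by under eq_bigr => j jT do rewrite ffunE jT.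
    by move=> j /negbTE jT; rewrite ffunE jT scale0r.
exists al; apply/andP; split.
  have /set0Pn[i] := a0; rewrite inE => ai.
  by apply/existsP; exists i; rewrite ai andbT (subsetP aT) ?inE.
move: aK; rewrite /dep_vector (bigID (mem T)) /= [X in _ + X]big1 ?addr0 //.
move=> j jT; suff /eqP->: al j == 0 by rewrite scale0r.
by apply: contraR jT => aj; rewrite (subsetP aT) ?inE.
Qed.

Lemma dep_vector_comb al be (c : F) :
  dep_vector al -> dep_vector be -> dep_vector [ffun i => al i - c * be i].
Proof.
rewrite /dep_vector => aK bK.
under eq_bigr => i _ do rewrite ffunE scalerBl -scalerA.
by rewrite sumrB -scaler_sumr addmx_sub // eqmx_opp scalemx_sub.
Qed.

Definition circuit C : bool :=
  mdep A K C && [forall C' : {set 'I_n}, (C' \proper C) ==> ~~ mdep A K C'].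

Lemma mcircuitE S C : mcircuit A K S C = (C \subset S) && circuit C.
Proof. by []. Qed.

(** A relation whose support misses part of [C] would make a proper subset dependent. *)
Lemma circuit_vector C : circuit C -> exists2 al, fsupp al = C & dep_vector al.
Proof.
case/andP=> /mdepP[al [a0 aC aK]] /forallP minC; exists al => //.
apply/eqP; move: aC; rewrite subEproper => /orP[//|/(implyP (minC _))/mdepP[]].
by exists al.
Qed.

Lemma circuit_proper C C' : circuit C -> circuit C' -> C' \proper C -> False.
Proof. by case/andP=> _ /forallP/(_ C')/implyP h /andP[d _] /h; rewrite d. Qed.

(** Induction on the size of the support. If it is not a circuit, some [be] has strictly smaller
    support: either [be] already involves [y], or subtracting the multiple of [be] that cancels one
    coordinate [i] shrinks the support of [al] and leaves the coefficient at [y] unchanged. *)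
Lemma circuit_in_fsupp al y :
  dep_vector al -> y \in fsupp al ->
  exists C, [/\ circuit C, y \in C & C \subset fsupp al].
Proof.
have [N] := ubnP #|fsupp al|; elim: N al => // N IH al leN aK ya.
have [cal|] := boolP (circuit (fsupp al)); first by exists (fsupp al).
have dal : mdep A K (fsupp al).
  by apply/mdepP; exists al; split=> //; apply/set0Pn; exists y.
rewrite /circuit dal /= negb_forall => /existsP[C'].
rewrite negb_imply negbK => /andP[C'al /mdepP[be [b0 bC' bK]]].
have bal := sub_proper_trans bC' C'al.
have smaller ga : fsupp ga \proper fsupp al -> dep_vector ga -> y \in fsupp ga ->
    exists C, [/\ circuit C, y \in C & C \subset fsupp al].
  move=> gal gK yg; have [|C [cC yC Cg]] := IH ga _ gK yg.
    by apply: leq_trans (proper_card gal) _; rewrite -ltnS.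
  by exists C; split=> //; apply: subset_trans Cg (proper_sub gal).
have [yb|yb] := boolP (y \in fsupp be); first exact: smaller yb.
have /set0Pn[i ib] := b0.
have := ib; rewrite inE => bi.
apply: (smaller [ffun j => al j - al i / be i * be j]).
- apply/properP; split.
    apply/subsetP => j; rewrite inE ffunE; apply: contraR => ja.
    have jb : j \notin fsupp be by apply: contra ja; apply: (subsetP (proper_sub bal)).
    move: ja jb; rewrite !inE !negbK => /eqP-> /eqP->.
    by rewrite mulr0 subr0.
  exists i; first exact: (subsetP (proper_sub bal)).
  by rewrite inE ffunE divfK // subrr eqxx.
- exact: dep_vector_comb.
- move: ya yb; rewrite !inE ffunE negbK => ya /eqP->.
  by rewrite mulr0 subr0.
Qed.

(** Subtract from the relation of [C1] the multiple of that of [C2] cancelling [e]. The coefficient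
    at [f] survives because [f] lies outside [C2], and the support of the difference contains a
    circuit through [f]. *)
Lemma circuit_strong_elim C1 C2 e f :
  circuit C1 -> circuit C2 -> e \in C1 -> e \in C2 -> f \in C1 -> f \notin C2 ->
  exists C, [/\ circuit C, f \in C & C \subset (C1 :|: C2) :\ e].
Proof.
move=> /circuit_vector[al <- aK] /circuit_vector[be <- bK].
rewrite !inE negbK => ae be0 fa /eqP fb.
have gK := dep_vector_comb (al e / be e) aK bK.
have [|C [cC fC Cg]] := @circuit_in_fsupp _ f gK.
  by rewrite inE ffunE fb mulr0 subr0.
exists C; split=> //; apply: subset_trans Cg _.
apply/subsetP => j; rewrite !inE ffunE.
have [->|_] /= := eqVneq j e; first by rewrite divfK // subrr eqxx.
rewrite -negb_and; apply: contra => /andP[/eqP-> /eqP->].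
by rewrite mulr0 subr0.
Qed.

(* Take a pair minimizing [#|C1 :|: C2|]: eliminating a common element once for
   each of [y] and [z] yields a meeting pair with a smaller union. *)
Lemma circuit_joining C1 C2 y z :
  circuit C1 -> circuit C2 -> y \in C1 -> z \in C2 -> C1 :&: C2 != set0 ->
  exists C, [/\ circuit C, y \in C, z \in C & C \subset C1 :|: C2].
Proof.
have [N] := ubnP #|C1 :|: C2|; elim: N C1 C2 => // N IH C1 C2 leN c1 c2 y1 z2 meet.
have [y2|y2] := boolP (y \in C2); first by exists C2; rewrite subsetUr.
have [z1|z1] := boolP (z \in C1); first by exists C1; rewrite subsetUl.
have smaller C C' : circuit C -> circuit C' -> y \in C -> z \in C' ->
    C :&: C' != set0 -> C :|: C' \proper C1 :|: C2 ->
    exists C, [/\ circuit C, y \in C, z \in C & C \subset C1 :|: C2].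
  move=> c c' yC zC' CC' sub; have [|D [cD yD zD Dsub]] := IH C C' _ c c' yC zC' CC'.
    by apply: leq_trans (proper_card sub) _; rewrite -ltnS.
  by exists D; split=> //; apply: subset_trans Dsub (proper_sub sub).
have /set0Pn[e /setIP[e1 e2]] := meet.
have [C3 [c3 y3 sub3]] := circuit_strong_elim c1 c2 e1 e2 y1 y2.
have [C4 [c4 z4 sub4]] := circuit_strong_elim c2 c1 e2 e1 z2 z1.
rewrite setUC in sub4.
have [s3 e3] := subsetD1P sub3; have [s4 e4] := subsetD1P sub4.
have not_sub C C' : circuit C -> circuit C' -> e \in C -> e \notin C' ->
    ~~ (C' \subset C).
  move=> c c' eC eC'; apply/negP => sub; apply: (circuit_proper c c').
  by apply/properP; split=> //; exists e.
have /subsetPn[u u3 u1] := not_sub _ _ c1 c3 e1 e3.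
have u2 : u \in C2 by move/subsetP/(_ _ u3): s3; rewrite inE (negbTE u1).
have /subsetPn[w w4 w2] := not_sub _ _ c2 c4 e2 e4.
have w1 : w \in C1 by move/subsetP/(_ _ w4): s4; rewrite inE (negbTE w2) orbF.
(* If [w] is outside [C3], the pair [C3], [C2] meets in [u] and its union loses [w]; otherwise [C3],
   [C4] meet in [w] and their union loses [e]. *)
have [w3|w3] := boolP (w \in C3); last first.
  apply: (smaller C3 C2) => //; first by apply/set0Pn; exists u; rewrite inE u3.
  apply/properP; split; first by rewrite subUset s3 subsetUr.
  by exists w; rewrite inE ?w1 // negb_or w3.
apply: (smaller C3 C4) => //; first by apply/set0Pn; exists w; rewrite inE w3.
apply/properP; split; first by rewrite subUset s3.
by exists e; rewrite inE ?e1 // negb_or e3.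
Qed.

(** The two circuits meet in [x], so [circuit_joining] applies, and the circuit it yields stays in
    their union, hence in [S]. *)
Lemma common_circuit_trans S x y z :
  common_circuit A K S x y -> common_circuit A K S x z -> common_circuit A K S y z.
Proof.
move=> /existsP[C1 /and3P[]]; rewrite mcircuitE => /andP[s1 c1] x1 y1.
move=> /existsP[C2 /and3P[]]; rewrite mcircuitE => /andP[s2 c2] x2 z2.
have [|C [cC yC zC sC]] := circuit_joining c1 c2 y1 z2.
  by apply/set0Pn; exists x; rewrite inE x1.
apply/existsP; exists C; rewrite mcircuitE cC yC zC !andbT.
by apply: subset_trans sC _; rewrite subUset s1.
Qed.

(** Connectedness of the component asks for circuits inside the component, not just inside [S]. A
    circuit through [y] and [z] qualifies: each of its elements shares it with [y], hence is linked
    to [x]. *)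
Lemma mcomponent_connected S x :
  mconnected A K (mcomponent A K S x).
Proof.
apply/forall_inP => y; rewrite inE => /andP[yS xy].
apply/forall_inP => z; rewrite inE => /andP[zS xz].
apply/implyP => yz.
have ccC u v : common_circuit A K S u v -> common_circuit A K S v u.
  by case/existsP=> C /and3P[cC uC vC]; apply/existsP; exists C; rewrite cC uC vC.
have /existsP[C /and3P[]] : common_circuit A K S y z.
  case/predU1P: xy => [yx|xy]; case/predU1P: xz => [zx|xz].
  - by rewrite yx zx eqxx in yz.
  - by rewrite yx.
  - by rewrite zx; apply: ccC.
  - exact: common_circuit_trans xz.
rewrite mcircuitE => /andP[sC cC] yC zC.
apply/existsP; exists C; rewrite mcircuitE cC yC zC !andbT.
apply/subsetP => w wC; rewrite inE (subsetP sC) //=.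
have yw : common_circuit A K S y w.
  by apply/existsP; exists C; rewrite mcircuitE sC cC yC wC.
case/predU1P: xy => [<-|xy]; first by rewrite yw orbT.
by rewrite (common_circuit_trans (ccC _ _ xy) yw) orbT.
Qed.

(** Trades a maximum of cardinalities for a condition that quantifies over sets only, as a formula
    can. *)
Lemma mrank_eq0 S :
  mrank A K S = 0%N <-> forall T, T \subset S -> ~~ mdep A K T -> T = set0.
Proof.
split=> [r0 T TS Ti|h].
  apply/eqP; rewrite -cards_eq0 -leqn0 -r0.
  by apply: (bigmax_sup T) => //; rewrite TS.
apply/eqP; rewrite -leqn0; apply/bigmax_leqP => T /andP[TS Ti].
by rewrite (h T) ?cards0.
Qed.

End Circuits.

(** * Unfolding the recursion for csd along the depth *)

Section Csd.
Variables (F : finFieldType) (m n : nat) (A : 'M[F]_(m, n)).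
Implicit Types (K : 'M[F]_m) (S : {set 'I_n}).

(** The rank 0 and contraction clauses alone. Keeping [mconnected] inside makes this imply [csd_le]
    for every [S], connected or not. *)
Definition csd_connected_le S K d : Prop :=
  mrank A K S = 0%N \/
  if d is d'.+1 then mconnected A K S /\ exists v : 'rV[F]_m, csd_le A S (K + v)%MS d'
  else False.

Lemma csd_connected_leP S K d :
  mconnected A K S -> csd_le A S K d <-> csd_connected_le S K d.
Proof.
move=> con; split; last first.
  have [r0|r0] := eqVneq (mrank A K S) 0%N; first by move=> _; apply: csd_rank0.
  case=> [/eqP|]; first by rewrite (negbTE r0).
  by case: d => // d [_ [v cv]]; apply: csd_contract cv.
move=> c; case: c con => {S K d}.
- by move=> S K d r0 _; left.
- by move=> S K d _ /negbTE->.
- by move=> S K d v _ con cv _; right; split=> //; exists v.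
Qed.

(** The clause for disconnected sets leaves [d] unchanged, which blocks a plain recursion on [d].
    Since components are connected, that clause is used at most once before the next contraction. *)
Lemma csd_leP S K d :
  csd_le A S K d <->
  csd_connected_le S K d \/
  (~ mconnected A K S /\
   forall x, x \in S -> csd_connected_le (mcomponent A K S x) K d).
Proof.
have [con|dis] := boolP (mconnected A K S).
  split=> [/(csd_connected_leP _ con)|[/(csd_connected_leP _ con)|[]]] //.
  by left.
split=> [c|].
  case: c dis => {S K d}.
  - by move=> S K d r0 _; left; left.
  - move=> S K d _ dis comp _; right; split; first exact/negP.
    move=> x xS; apply/csd_connected_leP; first exact: mcomponent_connected.
    by apply: comp; exists x.
  - by move=> S K d v _ ->.
have [r0|r0] := eqVneq (mrank A K S) 0%N; first by move=> _; apply: csd_rank0.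
case=> [[/eqP|]|[_ comp]]; first by rewrite (negbTE r0).
  by case: d => // d []; rewrite (negbTE dis).
apply: csd_disconn => // _ [x xS ->].
apply/csd_connected_leP; last exact: comp.
exact: mcomponent_connected.
Qed.

End Csd.

(** * Closing formulas *)

Section Closing.
Variable F : Type.
Implicit Types (phi : cmso F) (b : seq nat).

(** Every atom mentions a variable. A set variable is chosen because it always has a value; [close2]
    binds it later. *)
Definition cfalse : cmso F := CAnd (CMod 0 1 0) (CNot (CMod 0 1 0)).

(* Closing first-order variables by quantifiers would fail on the empty
   structure; unassigned atoms are false, so they are replaced by [cfalse]. *)
Fixpoint close1 b phi : cmso F :=
  match phi with
  | CR x => if x \in b then CR x else cfalse
  | CC x => if x \in b then CC x else cfalse
  | CEntry a x y => if (x \in b) && (y \in b) then CEntry a x y else cfalse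
  | CEq x y => if (x \in b) && (y \in b) then CEq x y else cfalse
  | CIn x X => if x \in b then CIn x X else cfalse
  | CMod r p X => CMod r p X
  | CNot p => CNot (close1 b p)
  | CAnd p q => CAnd (close1 b p) (close1 b q)
  | COr p q => COr (close1 b p) (close1 b q)
  | CEx1 x p => CEx1 x (close1 (x :: b) p)
  | CAll1 x p => CAll1 x (close1 (x :: b) p)
  | CEx2 X p => CEx2 X (close1 b p)
  | CAll2 X p => CAll2 X (close1 b p)
  end.

Lemma fv1_close1 b phi : {subset fv1 (close1 b phi) <= b}.
Proof.
have atom2 x y z : (x \in b) && (y \in b) -> z \in [:: x; y] -> z \in b.
  by case/andP=> xb yb; rewrite !inE => /orP[]/eqP->.
elim: phi b atom2 => //= [x|x|a x y|x y|x X|p IHp q IHq|p IHp q IHq|x p IHp|x p IHp] b atom2 z.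
- by case: ifP => //=; rewrite inE => xb /eqP->.
- by case: ifP => //=; rewrite inE => xb /eqP->.
- by case: ifP => // xyb; apply: atom2.
- by case: ifP => // xyb; apply: atom2.
- by case: ifP => //=; rewrite inE => xb /eqP->.
- by rewrite mem_cat => /orP[/IHp|/IHq]; apply.
- by rewrite mem_cat => /orP[/IHp|/IHq]; apply.
- rewrite mem_filter => /andP[zx /IHp]; rewrite inE (negbTE zx); apply.
  by move=> u v w /andP[ub vb]; rewrite !inE => /orP[]/eqP->.
- rewrite mem_filter => /andP[zx /IHp]; rewrite inE (negbTE zx); apply.
  by move=> u v w /andP[ub vb]; rewrite !inE => /orP[]/eqP->.
Qed.

Lemma sat_cfalse (M : sigma_struct F) e1 e2 : ~ @sat F M e1 e2 cfalse.
Proof. by case. Qed.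

Lemma sat_close1 (M : sigma_struct F) b phi e1 e2 :
  (forall x, x \notin b -> e1 x = None) ->
  @sat F M e1 e2 (close1 b phi) <-> @sat F M e1 e2 phi.
Proof.
have cf e1' e2' : @sat F M e1' e2' cfalse <-> False by split=> // /sat_cfalse.
elim: phi b e1 e2 => /= [x|x|a x y|x y|x X|r s X|p IHp|p IHp q IHq|p IHp q IHq
                        |x p IHp|x p IHp|X p IHp|X p IHp] b e1 e2 eb //.
- by case: ifP => // /negbT xb; rewrite (eb _ xb).
- by case: ifP => // /negbT xb; rewrite (eb _ xb).
- case: ifP => // /negbT; rewrite negb_and => /orP[xb|yb].
    by rewrite (eb _ xb).
  by rewrite (eb _ yb); case: (e1 x).
- case: ifP => // /negbT; rewrite negb_and => /orP[xb|yb].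
    by rewrite (eb _ xb).
  by rewrite (eb _ yb); case: (e1 x).
- by case: ifP => // /negbT xb; rewrite (eb _ xb).
- by have := IHp b e1 e2 eb; tauto.
- by have := IHp b e1 e2 eb; have := IHq b e1 e2 eb; tauto.
- by have := IHp b e1 e2 eb; have := IHq b e1 e2 eb; tauto.
- have h u : @sat F M (upd1 e1 x u) e2 (close1 (x :: b) p) <-> sat (upd1 e1 x u) e2 p.
    apply: IHp => y; rewrite inE negb_or /upd1 => /andP[/negbTE-> yb].
    exact: eb.
  by split=> -[u /h ?]; exists u.
- have h u : @sat F M (upd1 e1 x u) e2 (close1 (x :: b) p) <-> sat (upd1 e1 x u) e2 p.
    apply: IHp => y; rewrite inE negb_or /upd1 => /andP[/negbTE-> yb].
    exact: eb.
  by split=> H u; apply/h.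
- by split=> -[Z /IHp H]; exists Z; apply: H.
- by split=> H Z; have := H Z => /IHp; apply.
Qed.

Definition close2 (s : seq nat) phi : cmso F := foldr (fun X => @CEx2 F X) phi s.

Lemma fv1_close2 s phi : fv1 (close2 s phi) = fv1 phi.
Proof. by elim: s. Qed.

Lemma fv2_close2 s phi : fv2 (close2 s phi) = [seq X <- fv2 phi | X \notin s].
Proof.
elim: s => [|Y s IHs] /=; first by rewrite filter_predT.
by rewrite IHs -filter_predI; apply: eq_filter => X /=; rewrite inE negb_or.
Qed.

(** Dummy set quantifiers are safe even over an empty universe, where [set0] is still a witness. *)
Lemma sat_close2 (M : sigma_struct F) s phi e1 e2 (P : Prop) :
  (forall e2, @sat F M e1 e2 phi <-> P) ->
  @sat F M e1 e2 (close2 s phi) <-> P.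
Proof.
move=> h; elim: s e2 => //= X s IHs e2.
by split=> [[Z /IHs]|p] //; exists set0; apply/IHs.
Qed.

(** The index type [I] lets a single sentence serve a whole family of structures. *)
Lemma closed_sentence (I : Type) (M : I -> sigma_struct F) (P : I -> Prop) phi :
  (forall i e1 e2, @sat F (M i) e1 e2 phi <-> P i) ->
  exists psi, cmso_sentence psi /\ forall i, models (M i) psi <-> P i.
Proof.
move=> h; set chi := close1 [::] phi; exists (close2 (fv2 chi) chi); split.
  split.
    rewrite fv1_close2; apply/eqP; rewrite -size_eq0 -leqn0 leqNgt.
    apply/negP => ne; have := @fv1_close1 [::] phi (nth 0%N (fv1 chi) 0).
    by rewrite mem_nth // => /(_ isT).
  rewrite fv2_close2; apply/eqP; rewrite -size_eq0 size_filter -leqn0 leqNgt -has_count.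
  by apply/hasPn => X; rewrite negbK.
move=> i; apply: sat_close2 => e2.
by split=> [/sat_close1 s|p]; [apply/(h i); apply: s | apply/sat_close1 => //; apply/h].
Qed.

End Closing.

(** * Definable relations *)

Section Definability.
Variable F : finFieldType.

Notation univ m n := ('I_m + 'I_n)%type.
Definition elem_env m n := nat -> option (univ m n).
Definition set_env m n := nat -> {set univ m n}.
Definition env_rel := forall m n, 'M[F]_(m, n) -> elem_env m n -> set_env m n -> Prop.
Definition env_test := forall m n, 'M[F]_(m, n) -> elem_env m n -> set_env m n -> bool.
Definition env_term := forall m n, 'M[F]_(m, n) -> elem_env m n -> set_env m n -> F.

Definition updE m n (e : elem_env m n) x u : elem_env m n :=
  fun y => if y == x then Some u else e y.
Lemma updEE m n (e : elem_env m n) x u : updE e x u x = Some u.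
Proof. by rewrite /updE eqxx. Qed.

Definition updS m n (e : set_env m n) X Z : set_env m n :=
  fun Y => if Y == X then Z else e Y.

Definition definable (P : env_rel) : Prop :=
  exists phi : cmso F, forall m n (A : 'M[F]_(m, n)) (e1 : elem_env m n) (e2 : set_env m n),
    @sat F (S_of_matrix A) e1 e2 phi <-> P m n A e1 e2.

Lemma definable_ext (P Q : env_rel) :
  (forall m n A e1 e2, P m n A e1 e2 <-> Q m n A e1 e2) -> definable P -> definable Q.
Proof.
by move=> PQ [phi h]; exists phi => m n A e1 e2; rewrite h.
Qed.

Lemma definable_not (P : env_rel) :
  definable P -> definable (fun m n A e1 e2 => ~ P m n A e1 e2).
Proof. by case=> phi h; exists (CNot phi) => m n A e1 e2 /=; rewrite h. Qed.

Lemma definable_and (P Q : env_rel) : definable P -> definable Q ->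
  definable (fun m n A e1 e2 => P m n A e1 e2 /\ Q m n A e1 e2).
Proof.
by move=> [phi h] [psi k]; exists (CAnd phi psi) => m n A e1 e2 /=; rewrite h k.
Qed.

Lemma definable_or (P Q : env_rel) : definable P -> definable Q ->
  definable (fun m n A e1 e2 => P m n A e1 e2 \/ Q m n A e1 e2).
Proof.
by move=> [phi h] [psi k]; exists (COr phi psi) => m n A e1 e2 /=; rewrite h k.
Qed.

(** The logic has no implication, so it is encoded as a disjunction; the excluded middle this takes
    comes from the premise being boolean. *)
Lemma definable_imp (P : env_test) (Q : env_rel) : definable P -> definable Q ->
  definable (fun m n A e1 e2 => P m n A e1 e2 -> Q m n A e1 e2).
Proof.
move=> dP dQ; apply: definable_ext (definable_or (definable_not dP) dQ).
move=> m n A e1 e2; split=> [[nP|q] // /nP|PQ] //.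
by have [p|/negP np] := boolP (P m n A e1 e2); [right; apply: PQ | left].
Qed.

Lemma definable_const (b : bool) : definable (fun m n A e1 e2 => b).
Proof.
have dF : definable (fun m n A e1 e2 => false).
  by exists (cfalse F) => m n A e1 e2; split=> // /sat_cfalse.
case: b => //; apply: definable_ext (definable_not dF).
by move=> m n A e1 e2; split.
Qed.

Lemma definable_exists_fin (I : finType) (P : I -> env_rel) :
  (forall i, definable (P i)) -> definable (fun m n A e1 e2 => exists i, P i m n A e1 e2).
Proof.
move=> dP.
suff: definable (fun m n A e1 e2 => exists2 i, i \in enum I & P i m n A e1 e2).
  apply: definable_ext => m n A e1 e2.
  by split=> [[i _ p]|[i p]]; exists i; rewrite ?mem_enum.
elim: (enum I) => [|i s IHs].
  by apply: definable_ext (definable_const false) => m n A e1 e2; split=> // -[].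
apply: definable_ext (definable_or (dP i) IHs) => m n A e1 e2; split.
  by case=> [p|[j js p]]; [exists i | exists j] => //; rewrite inE ?eqxx ?js ?orbT.
by case=> j /predU1P[->|js] p; [left | right; exists j].
Qed.

Lemma definable_exists1 x (P : env_rel) : definable P ->
  definable (fun m n A e1 e2 => exists u, P m n A (updE e1 x u) e2).
Proof.
case=> phi h; exists (CEx1 x phi) => m n A e1 e2 /=.
by split=> -[u p]; exists u; apply/h.
Qed.

Lemma definable_forall1 x (P : env_rel) : definable P ->
  definable (fun m n A e1 e2 => forall u, P m n A (updE e1 x u) e2).
Proof.
case=> phi h; exists (CAll1 x phi) => m n A e1 e2 /=.
by split=> p u; apply/h; apply: p.
Qed.

Lemma definable_exists2 X (P : env_rel) : definable P ->
  definable (fun m n A e1 e2 => exists Z, P m n A e1 (updS e2 X Z)).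
Proof.
case=> phi h; exists (CEx2 X phi) => m n A e1 e2 /=.
by split=> -[u p]; exists u; apply/h.
Qed.

Lemma definable_forall2 X (P : env_rel) : definable P ->
  definable (fun m n A e1 e2 => forall Z, P m n A e1 (updS e2 X Z)).
Proof.
case=> phi h; exists (CAll2 X phi) => m n A e1 e2 /=.
by split=> p u; apply/h; apply: p.
Qed.

(** * Quantifying over sets of columns and over field-valued functions *)

Definition agree m n k (e e' : set_env m n) := forall Y, (Y < k)%N -> e Y = e' Y.

Lemma agree_sym m n k (e e' : set_env m n) : agree k e e' -> agree k e' e.
Proof. by move=> ee Y Yk; rewrite ee. Qed.

Lemma agree_le m n k k' (e e' : set_env m n) : (k <= k')%N -> agree k' e e' -> agree k e e'.
Proof. by move=> kk ee Y Yk; apply: ee; apply: leq_trans kk. Qed.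

Lemma agree_updS m n k X (e : set_env m n) Z : (k <= X)%N -> agree k e (updS e X Z).
Proof.
by move=> kX Y Yk; rewrite /updS; case: eqP Yk => // ->; rewrite ltnNge kX.
Qed.

(** Rows in a set variable are dropped, so quantifiers over sets of columns need no
    relativization. *)
Definition cset m n (e : set_env m n) X : {set 'I_n} := [set j | inr j \in e X].

Lemma cset_agree m n k X (e e' : set_env m n) :
  agree k e e' -> (X < k)%N -> cset e X = cset e' X.
Proof. by move=> ee Xk; rewrite /cset ee. Qed.

Lemma cset_updS m n (e : set_env m n) X (T : {set 'I_n}) :
  cset (updS e X (inr @: T)) X = T.
Proof.
apply/setP => j; rewrite inE /updS eqxx mem_imset //.
exact: inr_inj.
Qed.

Definition set_rel := forall m n, 'M[F]_(m, n) -> elem_env m n -> set_env m n ->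
  {set 'I_n} -> Prop.

Definition local_set k (Q : set_rel) := forall m n A e1 (e2 e2' : set_env m n) T,
  agree k e2 e2' -> Q m n A e1 e2 T -> Q m n A e1 e2' T.

Lemma definable_exists_set k (Q : set_rel) : local_set k Q ->
  definable (fun m n A e1 e2 => Q m n A e1 e2 (cset e2 k)) ->
  definable (fun m n A e1 e2 => exists T, Q m n A e1 e2 T).
Proof.
move=> loc dQ; apply: definable_ext (definable_exists2 k dQ) => m n A e1 e2.
split=> [[Z q]|[T q]].
  by exists (cset (updS e2 k Z) k); apply: loc q; apply/agree_sym/agree_updS.
by exists (inr @: T); rewrite cset_updS; apply: loc q; apply: agree_updS.
Qed.

Lemma definable_forall_set k (Q : set_rel) : local_set k Q ->
  definable (fun m n A e1 e2 => Q m n A e1 e2 (cset e2 k)) ->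
  definable (fun m n A e1 e2 => forall T, Q m n A e1 e2 T).
Proof.
move=> loc dQ; apply: definable_ext (definable_forall2 k dQ) => m n A e1 e2.
split=> [q T|q Z].
  have := q (inr @: T); rewrite cset_updS; apply: loc.
  exact/agree_sym/agree_updS.
by apply: loc (q _); apply: agree_updS.
Qed.

(* A function [f : univ -> F] is stored in the [#|F|] consecutive set variables
   from [k] on; every assignment decodes to some function, so no
   well-formedness condition is needed. *)
Definition decode m n (e : set_env m n) k : {ffun univ m n -> F} :=
  [ffun u => \sum_a if u \in e (k + enum_rank a)%N then a else 0].

Lemma decode_agree m n k k' (e e' : set_env m n) :
  agree k' e e' -> (k + #|F| <= k')%N -> decode e k = decode e' k.
Proof.
move=> ee kk; apply/ffunP => u; rewrite !ffunE; apply: eq_bigr => a _.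
by rewrite ee //; apply: leq_trans kk; rewrite ltn_add2l.
Qed.

Lemma decode_surj m n k (e : set_env m n) (f : {ffun univ m n -> F}) :
  exists2 e', agree k e e' & decode e' k = f.
Proof.
(* Each [u] is put only into the set numbered by [f u], so its decoding sum has a single
   nonvanishing candidate. *)
exists (fun Y => if (Y < k)%N then e Y else [set u | (k + enum_rank (f u))%N == Y]).
  by move=> Y ->.
apply/ffunP => u; rewrite ffunE (bigD1 (f u)) //= big1 => [|a afu].
  by rewrite ltnNge leq_addr inE eqxx addr0.
rewrite ltnNge leq_addr inE eqn_add2l; case: eqP => // /ord_inj/enum_rank_inj fu.
by rewrite fu eqxx in afu.
Qed.

(** As [P] reads only variables below [k + j], varying the whole assignment from [k] on amounts to
    [j] set quantifiers, the last variable being quantified innermost. *)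
Lemma definable_exists_block k j (P : env_rel) :
  (forall m n A e1 (e2 e2' : set_env m n), agree (k + j) e2 e2' ->
     P m n A e1 e2 -> P m n A e1 e2') ->
  definable P ->
  definable (fun m n A e1 e2 => exists2 e2', agree k e2 e2' & P m n A e1 e2').
Proof.
elim: j P => [|j IHj] P loc dP.
  apply: definable_ext dP => m n A e1 e2; rewrite addn0 in loc.
  by split=> [p|[e2' ee p]]; [exists e2 | apply: loc p; apply: agree_sym].
apply: definable_ext (IHj _ _ (definable_exists2 (k + j) dP)).
  move=> m n A e1 e2; split=> -[e2' ee p].
    case: p => Z p; exists (updS e2' (k + j) Z) => // Y Yk.
    by rewrite ee // (@agree_updS _ _ k (k + j) e2' Z) // leq_addr.
  exists e2' => //; exists (e2' (k + j)%N); apply: loc p => Y _.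
  by rewrite /updS; case: eqP => // ->.
move=> m n A e1 e2 e2' ee [Z p]; exists Z; apply: loc p => Y.
rewrite addnS ltnS leq_eqVlt /updS => /predU1P[->|Yk]; first by rewrite eqxx.
by case: eqP => // _; apply: ee.
Qed.

Definition fun_rel := forall m n, 'M[F]_(m, n) -> elem_env m n -> set_env m n ->
  {ffun univ m n -> F} -> Prop.

Lemma definable_exists_fun k (Q : fun_rel) :
  (forall m n A e1 (e2 e2' : set_env m n) f, agree k e2 e2' ->
     Q m n A e1 e2 f -> Q m n A e1 e2' f) ->
  definable (fun m n A e1 e2 => Q m n A e1 e2 (decode e2 k)) ->
  definable (fun m n A e1 e2 => exists f, Q m n A e1 e2 f).
Proof.
move=> loc dQ; apply: definable_ext (definable_exists_block (k := k) (j := #|F|) _ dQ).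
  move=> m n A e1 e2; split=> [[e2' ee q]|[f q]].
    by exists (decode e2' k); apply: loc q; apply: agree_sym.
  have [e2' ee ef] := decode_surj k e2 f.
  by exists e2'; rewrite ?ef //; apply: loc q.
move=> m n A e1 e2 e2' ee q; rewrite -(decode_agree ee) //; apply: loc q.
by apply: agree_le ee; rewrite leq_addr.
Qed.

End Definability.

(** * Field-valued terms *)

Section Terms.
Variable F : finFieldType.
Notation univ m n := ('I_m + 'I_n)%type.

Definition elem_in m n (e1 : elem_env m n) x (e2 : set_env m n) X : bool :=
  if e1 x is Some u then u \in e2 X else false.

Lemma definable_elem_in x X :
  @definable F (fun m n A e1 e2 => elem_in e1 x e2 X).
Proof. by exists (CIn x X) => m n A e1 e2; rewrite /elem_in /=; case: (e1 x). Qed.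

(** A term is given by its graph, one formula per value. Finiteness of [F] lets terms be composed by
    finite disjunctions over intermediate values. *)
Definition definable_term (t : env_term F) : Prop :=
  forall a, definable (fun m n A e1 e2 => t m n A e1 e2 = a).

Lemma definable_term_ext (t t' : env_term F) :
  (forall m n A e1 e2, t m n A e1 e2 = t' m n A e1 e2) ->
  definable_term t -> definable_term t'.
Proof.
by move=> tt dt a; apply: definable_ext (dt a) => m n A e1 e2; rewrite tt.
Qed.

Lemma definable_term_const (c : F) : definable_term (fun m n A e1 e2 => c).
Proof.
move=> a; apply: definable_ext (definable_const F (c == a)) => m n A e1 e2.
by split=> /eqP.
Qed.

Lemma definable_term_op (f : F -> F -> F) (t t' : env_term F) :
  definable_term t -> definable_term t' ->
  definable_term (fun m n A e1 e2 => f (t m n A e1 e2) (t' m n A e1 e2)).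
Proof.
move=> dt dt' a.
have d b c : definable (fun m n (A : 'M[F]_(m, n)) e1 e2 =>
    (t m n A e1 e2 = b /\ t' m n A e1 e2 = c) /\ f b c == a).
  apply: definable_and; first exact: definable_and.
  exact: definable_const.
apply: definable_ext (definable_exists_fin (fun b =>
  definable_exists_fin (fun c => d b c))) => m n A e1 e2.
split=> [[b [c [[<- <-] /eqP]]]|<-] //.
by exists (t m n A e1 e2), (t' m n A e1 e2).
Qed.

Lemma definable_term_sum (I : finType) (t : I -> env_term F) :
  (forall i, definable_term (t i)) ->
  definable_term (fun m n A e1 e2 => \sum_i t i m n A e1 e2).
Proof.
move=> dt; suff: forall s : seq I,
    definable_term (fun m n A e1 e2 => \sum_(i <- s) t i m n A e1 e2).
  exact.
elim=> [|i s IHs].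
  apply: definable_term_ext (definable_term_const 0) => m n A e1 e2.
  by rewrite big_nil.
apply: definable_term_ext (definable_term_op +%R (dt i) IHs) => m n A e1 e2.
by rewrite big_cons.
Qed.

Lemma definable_term_if (b : env_test F) (t : env_term F) :
  definable b -> definable_term t ->
  definable_term (fun m n A e1 e2 => if b m n A e1 e2 then t m n A e1 e2 else 0).
Proof.
move=> db dt a.
apply: definable_ext (definable_or (definable_and db (dt a))
  (definable_and (definable_not db) (definable_const F (0 == a)))) => m n A e1 e2.
case: (b _ _ _ _ _); split.
- by case=> [[]|[]].
- by left.
- by case=> [[]|[_ /eqP]].
- by move/eqP => a0; right.
Qed.

(** The image of a natural number in [F] depends only on its residue modulo the characteristic [p].
    So [Z] is made to hold the truth set of [P], and a disjunction over the residues [i] tests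
    [CMod i p Z]. *)
Lemma definable_term_card y Z (P : env_test F) :
  (forall m n A e1 (e2 e2' : set_env m n), agree Z e2 e2' ->
     P m n A e1 e2 = P m n A e1 e2') ->
  definable P ->
  definable_term (fun m n A e1 e2 => #|[set u | P m n A (updE e1 y u) e2]|%:R).
Proof.
move=> loc dP a; have [p p_pr pF] := finPcharP F.
have dIn := definable_elem_in y Z.
have dMod : definable (fun m n (A : 'M[F]_(m, n)) (e1 : elem_env m n) (e2 : set_env m n) =>
    exists i : 'I_p, #|e2 Z| = i %[mod p] /\ i%:R == a).
  apply: definable_exists_fin => i; apply: definable_and; last exact: definable_const.
  by exists (CMod i p Z).
have dIff := definable_and (definable_imp dIn dP) (definable_imp dP dIn).
apply: definable_ext (definable_exists2 Z (definable_and (definable_forall1 y dIff) dMod)).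
move=> m n A e1 e2 /=.
have inE' u B : elem_in (updE e1 y u) y (updS e2 Z B) Z = (u \in B).
  by rewrite /elem_in /updE /updS !eqxx.
have PE u B : P m n A (updE e1 y u) (updS e2 Z B) = P m n A (updE e1 y u) e2.
  by apply: loc; apply/agree_sym/agree_updS.
have cE B : updS e2 Z B Z = B by rewrite /updS eqxx.
split=> [[B [PB [i []]]]|ca].
  rewrite cE => cB /eqP ia.
  rewrite -ia -(GRing.natr_mod_pchar pF i) -cB (GRing.natr_mod_pchar pF).
  congr (_ %:R); apply: eq_card => u; rewrite inE.
  by have := PB u; rewrite inE' PE => -[BP PB']; apply/idP/idP.
exists [set u | P m n A (updE e1 y u) e2]; split=> [u|].
  by rewrite inE' PE inE.
exists (Ordinal (ltn_pmod #|[set u | P m n A (updE e1 y u) e2]| (prime_gt0 p_pr))).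
by rewrite cE /= modn_mod GRing.natr_mod_pchar // ca.
Qed.

(** The number of summands grows with the matrix, so they are grouped by value: the sum becomes one
    over [F] of each value times its number of occurrences. *)
Lemma definable_term_sum1 y Z (t : env_term F) :
  (forall m n A e1 (e2 e2' : set_env m n), agree Z e2 e2' ->
     t m n A e1 e2 = t m n A e1 e2') ->
  definable_term t ->
  definable_term (fun m n A e1 e2 => \sum_u t m n A (updE e1 y u) e2).
Proof.
move=> loc dt.
have dcard a : definable_term (fun m n (A : 'M[F]_(m, n)) e1 e2 =>
    #|[set u | t m n A (updE e1 y u) e2 == a]|%:R).
  apply: (definable_term_card y (Z := Z) (P := fun m n A e1 e2 => t m n A e1 e2 == a)).
    by move=> m n A e1 e2 e2' ee; rewrite (loc _ _ _ _ _ _ ee).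
  by apply: definable_ext (dt a) => m n A e1 e2; split=> /eqP.
(* Multiplication by the constant [a] is cast as a binary operation, whence the count given
   twice. *)
apply: definable_term_ext (definable_term_sum (fun a =>
  definable_term_op (fun c _ => c * a) (dcard a) (dcard a))) => m n A e1 e2.
rewrite (partition_big (fun u => t m n A (updE e1 y u) e2) predT) //=.
apply: eq_bigr => a _; rewrite (eq_bigr (fun=> a)) => [|u /eqP //].
rewrite sumr_const mulr_natl; congr (_ *+ _).
by apply: eq_card => u; rewrite inE.
Qed.

End Terms.

(** * Vectors, spans and dependence *)

Section Vectors.
Variable F : finFieldType.
Notation univ m n := ('I_m + 'I_n)%type.

Definition is_row m n (e1 : elem_env m n) x : bool :=
  if e1 x is Some (inl _) then true else false.

Definition is_col m n (e1 : elem_env m n) x : bool :=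
  if e1 x is Some (inr _) then true else false.

Lemma definable_is_row x : @definable F (fun m n A e1 e2 => is_row e1 x).
Proof. by exists (CR x) => m n A e1 e2; rewrite /is_row /=; case: (e1 x) => // -[]. Qed.

Lemma definable_is_col x : @definable F (fun m n A e1 e2 => is_col e1 x).
Proof. by exists (CC x) => m n A e1 e2; rewrite /is_col /=; case: (e1 x) => // -[]. Qed.

Definition entry m n (A : 'M[F]_(m, n)) (o o' : option (univ m n)) : F :=
  match o, o' with Some (inl r), Some (inr c) => A r c | _, _ => 0 end.

Lemma definable_entry x y :
  definable_term (fun m n A e1 e2 => @entry m n A (e1 x) (e1 y)).
Proof.
pose b a m n (A : 'M[F]_(m, n)) (e1 : elem_env m n) (e2 : set_env m n) :=
  if e1 x is Some (inl r) then if e1 y is Some (inr c) then A r c == a else false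
  else false.
have db a : definable (b a).
  exists (CEntry a x y) => m n A e1 e2; rewrite /b /=.
  by case: (e1 x) => [[r|c]|] //; case: (e1 y) => [[]|].
apply: definable_term_ext (definable_term_sum (fun a =>
  definable_term_if (db a) (definable_term_const a))) => m n A e1 e2.
rewrite /b; case: (e1 x) => [[r|c]|] /=; [|exact: big1..].
case: (e1 y) => [[r'|c]|] /=; [exact: big1| |exact: big1].
by rewrite (bigD1 (A r c)) //= eqxx big1 ?addr0 // => a; rewrite eq_sym => /negbTE->.
Qed.

Definition decode_at m n (e1 : elem_env m n) x (e2 : set_env m n) k : F :=
  if e1 x is Some u then decode F e2 k u else 0.

Lemma definable_decode_at x k :
  definable_term (fun m n (A : 'M[F]_(m, n)) e1 e2 => decode_at e1 x e2 k).
Proof.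
apply: definable_term_ext (definable_term_sum (fun a : F =>
  definable_term_if (definable_elem_in F x (k + enum_rank a))
                    (definable_term_const a))) => m n A e1 e2.
rewrite /decode_at /elem_in; case: (e1 x) => [u|]; first by rewrite ffunE.
by rewrite big1.
Qed.

Definition row_entry m n (w : 'rV[F]_m) (o : option (univ m n)) : F :=
  if o is Some (inl r) then w 0 r else 0.

(** Vectors depend on set variables only, so any element variable can run over their coordinates
    without capture. *)
Definition env_vec := forall m n, 'M[F]_(m, n) -> set_env m n -> 'rV[F]_m.

Definition definable_vec (w : env_vec) : Prop :=
  forall x, definable_term (fun m n A e1 e2 => row_entry (w m n A e2) (e1 x)).

Definition decode_row m n (e2 : set_env m n) k : 'rV[F]_m :=
  \row_r decode F e2 k (inl r).

Lemma definable_decode_row k : definable_vec (fun m n A e2 => decode_row e2 k).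
Proof.
move=> x; apply: definable_term_ext
  (definable_term_if (definable_is_row x) (definable_decode_at x k)) => m n A e1 e2.
by rewrite /row_entry /decode_at /is_row; case: (e1 x) => [[r|]|] //; rewrite mxE.
Qed.

(** The head of the list is the vector added last, so consing a block computes to the [K + v] of
    [csd_contract]. *)
Definition decode_span m n (e2 : set_env m n) (vs : seq nat) : 'M[F]_m :=
  foldr (fun k K => (K + decode_row e2 k)%MS) 0 vs.

(** Spanning vectors are removed one by one: [w] lies in K + v iff w - c v lies in K for one of the
    finitely many scalars [c]. The base case is a vanishing test at every element, where non-rows
    read 0. *)
Lemma definable_sub_span (w : env_vec) vs : definable_vec w ->
  definable (fun m n A e1 e2 => (w m n A e2 <= decode_span e2 vs)%MS).
Proof.
elim: vs w => [|k vs IHvs] w dw.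
  apply: definable_ext (definable_forall1 0%N (dw 0%N 0)) => m n A e1 e2 /=.
  rewrite submx0; split=> [w0|/eqP-> u].
    by apply/eqP/rowP => r; have := w0 (inl r); rewrite mxE.
  by case: u => // r; rewrite mxE.
have dwc (c : F) : definable_vec (fun m n A e2 => w m n A e2 - c *: decode_row e2 k).
  move=> x; apply: definable_term_ext (definable_term_op (fun a b => a - c * b)
    (dw x) (definable_decode_row k x)) => m n A e1 e2.
  by rewrite /row_entry; case: (e1 x) => [[r|]|]; rewrite ?mxE ?mulr0 ?subr0.
apply: definable_ext (definable_exists_fin (fun c => IHvs _ (dwc c))) => m n A e1 e2 /=.
split=> [[c sub]|/sub_addsmxP[[u a] /= ->]].
  rewrite -(subrK (c *: decode_row e2 k) (w m n A e2)) addmx_sub_adds //.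
  exact: scalemx_sub.
exists (a 0 0); rewrite {1}(mx11_scalar a) mul_scalar_mx addrK.
exact: submxMl.
Qed.

Definition lincomb m n (A : 'M[F]_(m, n)) (e2 : set_env m n) X k : 'rV[F]_m :=
  \sum_(i in cset e2 X) decode F e2 k (inr i) *: colv A i.

Lemma definable_lincomb X k :
  definable_vec (fun m n A e2 => lincomb A e2 X k).
Proof.
(* [Z] lies beyond [X] and beyond the block at [k], hence is fresh for counting; the summation
   variable [x.+1] is chosen to differ from the row [x]. *)
move=> x; set Z := maxn X.+1 (k + #|F|).
pose t m n (A : 'M[F]_(m, n)) (e1 : elem_env m n) e2 : F :=
  if elem_in e1 x.+1 e2 X then decode_at e1 x.+1 e2 k * entry A (e1 x) (e1 x.+1) else 0.
have dt : definable_term t.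
  apply: definable_term_if; first exact: definable_elem_in.
  apply: definable_term_op; first exact: definable_decode_at.
  exact: definable_entry.
apply: definable_term_ext (definable_term_sum1 x.+1 (Z := Z) _ dt); last first.
  move=> m n A e1 e2 e2' ee; rewrite /t /elem_in /decode_at.
  case: (e1 x.+1) => // u; rewrite (decode_agree ee) ?leq_maxr //.
  by rewrite ee // leq_maxl.
move=> m n A e1 e2; rewrite big_sumType /= big1 => [|r _]; last first.
  rewrite /t /updE eqxx /entry; case: ifP => // _.
  by case: (if _ then _ else _) => [[]|]; rewrite mulr0.
rewrite add0r /row_entry /lincomb.
have xx : (x == x.+1) = false by rewrite ltn_eqF.
case e1x: (e1 x) => [[r|c]|]; first rewrite summxE [RHS]big_mkcond; last 2 first.
- apply: big1 => i _; rewrite /t /entry /updE eqxx xx e1x mulr0.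
  by case: ifP.
- apply: big1 => i _; rewrite /t /entry /updE eqxx xx e1x mulr0.
  by case: ifP.
apply: eq_bigr => i _; rewrite /t /elem_in /decode_at /updE eqxx xx e1x inE.
by case: ifP => // _; rewrite !mxE.
Qed.

Definition below k (vs : seq nat) : bool := all (fun v => v + #|F| <= k)%N vs.

Lemma decode_span_agree m n k (e2 e2' : set_env m n) vs :
  agree k e2 e2' -> below k vs -> decode_span e2 vs = decode_span e2' vs.
Proof.
move=> ee; elim: vs => //= v vs IHvs /andP[vk /IHvs->].
by rewrite /decode_row (decode_agree ee vk).
Qed.

Lemma below_le k k' vs : (k <= k')%N -> below k vs -> below k' vs.
Proof. by move=> kk; apply: sub_all => v vk; apply: leq_trans kk. Qed.

Lemma definable_exists_vec k (Q : forall m n, 'M[F]_(m, n) -> elem_env m n ->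
    set_env m n -> 'rV[F]_m -> Prop) :
  (forall m n A e1 (e2 e2' : set_env m n) v, agree k e2 e2' ->
     Q m n A e1 e2 v -> Q m n A e1 e2' v) ->
  definable (fun m n A e1 e2 => Q m n A e1 e2 (decode_row e2 k)) ->
  definable (fun m n A e1 e2 => exists v, Q m n A e1 e2 v).
Proof.
move=> loc dQ; apply: definable_ext (definable_exists_fun (k := k)
  (Q := fun m n A e1 e2 f => Q m n A e1 e2 (\row_r f (inl r))) _ dQ) => [m n A e1 e2|].
  split=> [[f q]|[v q]]; first by exists (\row_r f (inl r)).
  exists [ffun u => if u is inl r then v 0 r else 0].
  by congr (Q _ _ _ _ _ _): q; apply/rowP => r; rewrite mxE ffunE.
by move=> m n A e1 e2 e2' f; apply: loc.
Qed.

Lemma definable_mdep vs T :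
  definable (fun m n A e1 e2 => mdep A (decode_span e2 vs) (cset e2 T)).
Proof.
(* A scratch index past [T] and past the end of every block in [vs], for the guessed
   coefficients. *)
pose k := foldr maxn T.+1 [seq (v + #|F|)%N | v <- vs].
have Tk : (T < k)%N.
  by rewrite /k; elim: (map _ _) => //= v s IHs; apply: leq_trans IHs (leq_maxr _ _).
have vsk : below k vs.
  rewrite /k; elim: (vs) => //= v s IHs; rewrite leq_maxl.
  by apply: below_le IHs; apply: leq_maxr.
have dne : definable (fun m n (A : 'M[F]_(m, n)) (e1 : elem_env m n) (e2 : set_env m n) =>
    exists u : univ m n, (elem_in (updE e1 0%N u) 0%N e2 T /\ is_col (updE e1 0%N u) 0%N) /\
                 ~ decode_at (updE e1 0%N u) 0%N e2 k = 0).
  apply: (definable_exists1 0%N (P := fun m n A e1 e2 => (elem_in e1 0%N e2 T /\ is_col e1 0%N) /\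
    ~ decode_at e1 0%N e2 k = 0)).
  apply: definable_and; last exact/definable_not/definable_decode_at.
  by apply: definable_and; [apply: definable_elem_in | apply: definable_is_col].
pose Q m n (A : 'M[F]_(m, n)) (e1 : elem_env m n) (e2 : set_env m n)
    (f : {ffun univ m n -> F}) := exists2 i, i \in cset e2 T & f (inr i) != 0 /\
  ((\sum_(i in cset e2 T) f (inr i) *: colv A i)%R <= decode_span e2 vs)%MS.
apply: definable_ext (definable_exists_fun (k := k) (Q := Q) _ _).
- move=> m n A e1 e2; split=> [[f [i iT [fi fK]]]|].
    apply/existsP; exists [ffun i => f (inr i)]; apply/andP; split.
      by apply/existsP; exists i; rewrite iT ffunE.
    by under eq_bigr => j _ do rewrite ffunE.
  case/existsP => al /andP[/existsP[i /andP[iT ali]] aK].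
  exists [ffun u => if u is inr i then al i else 0]; exists i; rewrite ?ffunE //.
  by split=> //; under eq_bigr => j _ do rewrite ffunE.
- move=> m n A e1 e2 e2' f ee [i]; rewrite (cset_agree ee Tk) (decode_span_agree ee vsk).
  by exists i.
apply: definable_ext (definable_and dne (definable_sub_span vs (definable_lincomb T k))).
move=> m n A e1 e2; rewrite /elem_in /is_col /decode_at /updE !eqxx.
split=> [[[[r|i] [[iT //]]] _ /eqP fi fK]|[i iT [fi fK]]].
  by exists i; rewrite // inE.
by split=> //; exists (inr i); rewrite inE in iT; split=> //; apply/eqP.
Qed.

End Vectors.

(** * Defining csd *)

Section CsdFormula.
Variable F : finFieldType.
Notation univ m n := ('I_m + 'I_n)%type.

Definition col_in m n (o : option (univ m n)) (T : {set 'I_n}) : bool :=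
  if o is Some (inr j) then j \in T else false.

Lemma definable_col_in x X :
  @definable F (fun m n A e1 e2 => col_in (e1 x) (cset e2 X)).
Proof.
apply: definable_ext (definable_and (definable_is_col F x) (definable_elem_in F x X)).
move=> m n A e1 e2; rewrite /is_col /elem_in /col_in.
by case: (e1 x) => [[r|j]|]; rewrite ?inE; split=> // -[].
Qed.

Lemma definable_subset X Y :
  @definable F (fun m n A e1 e2 => cset e2 X \subset cset e2 Y).
Proof.
apply: definable_ext (definable_forall1 0%N
  (definable_imp (definable_col_in 0 X) (definable_col_in 0 Y))) => m n A e1 e2.
split=> [XY|/subsetP XY [r|j]] //=; last exact: XY.
by apply/subsetP => j; apply: (XY (inr j)).
Qed.

Lemma definable_proper X Y :
  @definable F (fun m n A e1 e2 => cset e2 X \proper cset e2 Y).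
Proof.
apply: definable_ext (definable_and (definable_subset X Y)
  (definable_not (definable_subset Y X))) => m n A e1 e2.
by rewrite properE; split=> [[-> /negP]|/andP[-> /negP]].
Qed.

Lemma definable_eq_set0 X :
  @definable F (fun m n A e1 e2 => cset e2 X = set0).
Proof.
apply: definable_ext (definable_not (definable_exists1 0%N (definable_col_in 0 X))).
move=> m n A e1 e2; split=> [X0|X0 [[r|j]]] //=; last by rewrite X0 inE.
by apply/eqP/set0Pn => -[j jX]; apply: X0; exists (inr j).
Qed.

Lemma definable_eq_setT X :
  @definable F (fun m n A e1 e2 => cset e2 X = [set: 'I_n]).
Proof.
apply: definable_ext (definable_forall1 0%N
  (definable_imp (definable_is_col F 0) (definable_col_in 0 X))) => m n A e1 e2.
split=> [XT|XT [r|j] //= _]; last by rewrite XT inE.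
by apply/setP => j; rewrite [RHS]inE; apply: (XT (inr j)).
Qed.

Section Formulas.
Variables (k : nat) (vs : seq nat) (S : nat).
Hypotheses (vsk : below F k vs) (Sk : (S < k)%N).

Lemma definable_mrank_eq0 :
  definable (fun m n A e1 e2 => mrank A (decode_span F e2 vs) (cset e2 S) = 0%N).
Proof.
pose Q m n (A : 'M[F]_(m, n)) (e1 : elem_env m n) (e2 : set_env m n) (T : {set 'I_n}) :=
  T \subset cset e2 S -> ~~ mdep A (decode_span F e2 vs) T -> T = set0.
apply: definable_ext (definable_forall_set (k := k) (Q := Q) _ _).
- by move=> m n A e1 e2; rewrite mrank_eq0.
- move=> m n A e1 e2 e2' T ee.
  by rewrite /Q (cset_agree ee Sk) (decode_span_agree ee vsk).
- apply: definable_imp; first exact: definable_subset.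
  apply: definable_imp; last exact: definable_eq_set0.
  apply: definable_ext (definable_not (definable_mdep F vs k)) => m n A e1 e2.
  by split=> /negP.
Qed.

Lemma definable_mcircuit C : (C < k)%N ->
  definable (fun m n A e1 e2 =>
    mcircuit A (decode_span F e2 vs) (cset e2 S) (cset e2 C)).
Proof.
move=> Ck.
pose Q m n (A : 'M[F]_(m, n)) (e1 : elem_env m n) (e2 : set_env m n) (T : {set 'I_n}) :=
  T \proper cset e2 C -> ~ mdep A (decode_span F e2 vs) T.
have dQ : definable (fun m n A e1 e2 => forall T, Q m n A e1 e2 T).
  apply: (definable_forall_set (k := k)).
    move=> m n A e1 e2 e2' T ee.
    by rewrite /Q (cset_agree ee Ck) (decode_span_agree ee vsk).
  apply: definable_imp; first exact: definable_proper.
  exact/definable_not/definable_mdep.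
apply: definable_ext (definable_and (definable_subset C S)
  (definable_and (definable_mdep F vs C) dQ)) => m n A e1 e2.
split=> [[CS [dC minC]]|/and3P[CS dC /forallP minC]].
  apply/and3P; split=> //; apply/forallP => T; apply/implyP => TC.
  by apply/negP; apply: minC.
by split=> //; split=> // T /(implyP (minC T))/negP.
Qed.

End Formulas.

(** With the reflexive case included, one relation serves both connectedness and components. *)
Definition linked m n (A : 'M[F]_(m, n)) K T (o o' : option (univ m n)) : bool :=
  if (o, o') is (Some (inr i), Some (inr j)) then (j == i) || common_circuit A K T i j
  else false.

Lemma definable_linked k vs S x y : below F k vs -> (S < k)%N ->
  definable (fun m n A e1 e2 =>
    linked A (decode_span F e2 vs) (cset e2 S) (e1 x) (e1 y)).
Proof.
move=> vsk Sk.
pose Q m n (A : 'M[F]_(m, n)) (e1 : elem_env m n) (e2 : set_env m n) (T : {set 'I_n}) :=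
  mcircuit A (decode_span F e2 vs) (cset e2 S) T /\
  (col_in (e1 x) T /\ col_in (e1 y) T).
have dQ : definable (fun m n A e1 e2 => exists T, Q m n A e1 e2 T).
  apply: (definable_exists_set (k := k)).
    move=> m n A e1 e2 e2' T ee.
    by rewrite /Q (cset_agree ee Sk) (decode_span_agree ee vsk).
  apply: definable_and; last by apply: definable_and; apply: definable_col_in.
  (* The candidate circuit occupies [k], so the quantifier over its proper subsets moves to
     [k.+1]. *)
  apply: (definable_mcircuit (k := k.+1)); last exact: ltnSn.
  by apply: below_le vsk.
have dE : @definable F (fun m n A e1 e2 => is_col e1 x /\ exists2 u, e1 x = Some u & e1 y = Some u).
  apply: definable_and; first exact: definable_is_col.
  exists (CEq x y) => m n A e1 e2 /=; case: (e1 x) => [u|]; last by split=> // -[].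
  case: (e1 y) => [v|]; last by split=> // -[].
  by split=> [->|[w [->] [->]]] //; exists v.
apply: definable_ext (definable_or dE dQ) => m n A e1 e2.
rewrite /Q /linked /is_col; split=> [[]|].
- by case=> + [u xu yu]; rewrite xu yu; case: u {xu yu} => // j _; rewrite eqxx.
- case=> T [cT []]; case: (e1 x) => [[//|i]|//]; case: (e1 y) => [[//|j]|//] /= iT jT.
  by apply/orP; right; apply/existsP; exists T; rewrite cT iT jT.
- case: (e1 x) => [[//|i]|//]; case: (e1 y) => [[//|j]|//].
  case/predU1P => [->|/existsP[T /and3P[cT iT jT]]]; last by right; exists T.
  by left; split=> //; exists (inr i).
Qed.

Lemma definable_mconnected k vs S : below F k vs -> (S < k)%N ->
  definable (fun m n A e1 e2 => mconnected A (decode_span F e2 vs) (cset e2 S)).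
Proof.
move=> vsk Sk.
apply: definable_ext (definable_forall1 0%N (definable_forall1 1%N
  (definable_imp (definable_col_in 0 S) (definable_imp (definable_col_in 1 S)
  (definable_linked 0 1 vsk Sk))))) => m n A e1 e2.
split=> [con|/forall_inP con [r|i] [r'|j] //= iS jS].
  apply/forall_inP => i iS; apply/forall_inP => j jS; apply/implyP => ij.
  by have := con (inr i) (inr j) iS jS; rewrite /linked /= eq_sym (negbTE ij).
have := implyP (forall_inP (con i iS) j jS); rewrite /linked /= eq_sym.
by case: eqVneq => //= _; apply.
Qed.

Definition component m n (A : 'M[F]_(m, n)) K (T : {set 'I_n}) (o : option (univ m n)) : {set 'I_n} :=
  [set j in T | linked A K T o (Some (inr j))].

(** Boolean equality, because this serves as a premise for [definable_imp]. *)
Lemma definable_component k vs S x Y : below F k vs -> (S < k)%N ->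
  definable (fun m n A e1 e2 =>
    cset e2 Y == component A (decode_span F e2 vs) (cset e2 S) (e1 x)).
Proof.
move=> vsk Sk.
have dS := definable_and (definable_col_in x.+1 S) (definable_linked x x.+1 vsk Sk).
have dSb : definable (fun m n (A : 'M[F]_(m, n)) e1 e2 =>
    col_in (e1 x.+1) (cset e2 S) &&
    linked A (decode_span F e2 vs) (cset e2 S) (e1 x) (e1 x.+1)).
  by apply: definable_ext dS => m n A e1 e2; split=> /andP.
have dY := definable_col_in x.+1 Y.
apply: definable_ext (definable_forall1 x.+1
  (definable_and (definable_imp dY dSb) (definable_imp dSb dY))) => m n A e1 e2.
have xx : (x == x.+1) = false by rewrite ltn_eqF.
rewrite /updE eqxx xx; split=> [h|/eqP-> [r|j]] /=; rewrite ?inE //.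
by apply/eqP/setP => j; rewrite [RHS]inE; have [h1 h2] := h (inr j); apply/idP/idP.
Qed.

Lemma definable_csd_of_connected d vs :
  (forall k S, below F k vs -> (S < k)%N -> definable (fun m n A e1 e2 =>
     csd_connected_le A (cset e2 S) (decode_span F e2 vs) d)) ->
  forall k S, below F k vs -> (S < k)%N ->
  definable (fun m n A e1 e2 => csd_le A (cset e2 S) (decode_span F e2 vs) d).
Proof.
move=> dcon k S vsk Sk.
(* The hypothesis only treats sets held in a variable, so the component is introduced as a
   quantified [T] constrained by an equation. *)
pose Q m n (A : 'M[F]_(m, n)) (e1 : elem_env m n) (e2 : set_env m n) (T : {set 'I_n}) :=
  col_in (e1 0%N) (cset e2 S) ->
  T == component A (decode_span F e2 vs) (cset e2 S) (e1 0%N) ->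
  csd_connected_le A T (decode_span F e2 vs) d.
have dQ : definable (fun m n A e1 e2 => forall T, Q m n A e1 e2 T).
  apply: (definable_forall_set (k := k)).
    move=> m n A e1 e2 e2' T ee.
    by rewrite /Q (cset_agree ee Sk) (decode_span_agree ee vsk).
  apply: definable_imp; first exact: definable_col_in.
  apply: definable_imp; first exact: definable_component vsk Sk.
  by apply: dcon (ltnSn k); apply: below_le vsk.
apply: definable_ext (definable_or (dcon k S vsk Sk) (definable_and
  (definable_not (definable_mconnected vsk Sk)) (definable_forall1 0%N dQ))).
move=> m n A e1 e2; rewrite csd_leP; split=> -[?|[dis comp]]; [by left| |by left|].
  right; split=> // j jS; apply: (comp (inr j)); rewrite ?updEE //.
right; split=> // -[r|j] T; rewrite /Q updEE //= => jS /eqP->.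
exact: comp.
Qed.

Lemma definable_csd d k vs S : below F k vs -> (S < k)%N ->
  definable (fun m n A e1 e2 => csd_le A (cset e2 S) (decode_span F e2 vs) d).
Proof.
elim: d k vs S => [|d IHd] k vs S; apply: definable_csd_of_connected => {}k {}S vsk Sk.
  apply: definable_or (definable_mrank_eq0 vsk Sk) _.
  by apply: definable_ext (definable_const F false) => m n A e1 e2; split.
apply: definable_or (definable_mrank_eq0 vsk Sk) _.
apply: definable_and (definable_mconnected vsk Sk) _.
apply: (definable_exists_vec (k := k)).
  move=> m n A e1 e2 e2' v ee.
  by rewrite (cset_agree ee Sk) (decode_span_agree ee vsk).
(* The guessed vector fills the block starting at [k], so the next free index is [k + #|F|]. *)
apply: (IHd (k + #|F|)%N (k :: vs)); last exact: ltn_addr.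
by rewrite /= leqnn; apply: below_le vsk; apply: leq_addr.
Qed.

End CsdFormula.

Theorem theorem10 (F : finFieldType) (d : nat) :
  exists phi : cmso F, cmso_sentence phi /\
    forall (m n : nat) (A : 'M[F]_(m, n)),
      models (S_of_matrix A) phi <-> csd_matrix_le A d.
Proof.
(* The full ground set must also sit in a variable: it is guessed in variable 0, leaving 1 as the
   first free index. *)
have dcsd : definable (fun m n (A : 'M[F]_(m, n)) e1 e2 =>
    exists T, T = [set: 'I_n] /\ csd_le A T (decode_span F e2 [::]) d).
  apply: (definable_exists_set (k := 0)) => [m n A e1 e2 e2' T ee //|].
  apply: definable_and; first exact: definable_eq_setT.
  exact: (definable_csd d (k := 1)).
have [phi sat_phi] : definable (fun m n (A : 'M[F]_(m, n)) e1 e2 => csd_matrix_le A d).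
  apply: definable_ext dcsd => m n A e1 e2.
  by split=> [[_ [-> c]]|c] //; exists [set: 'I_n].
(* Dimensions and matrix are packed into one dependent pair, so that a single sentence is obtained
   for all sizes. *)
have [psi [psi_closed models_psi]] := closed_sentence
  (M := fun A : {m & {n & 'M[F]_(m, n)}} => S_of_matrix (tagged (tagged A)))
  (P := fun A => csd_matrix_le (tagged (tagged A)) d)
  (fun A => sat_phi _ _ (tagged (tagged A))).
exists psi; split=> // m n A.
exact: (models_psi (existT _ m (existT _ n A))).
Qed.
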